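(* For each integer $n\ge 2$, let $0<x^{(\Xi)}_{1,n}<\cdots<x^{(\Xi)}_{n-1,n}<1$ be the zeros of the polynomial $\widetilde{\Xi}_n$, and let $0<x^{(\Lambda)}_{1,n}<\cdots<x^{(\Lambda)}_{n-1,n}<1$ be the zeros of the polynomial $\widetilde{\Lambda}_n$ (both polynomials are defined in the context). Then $$\lim_{n\to\infty}\frac{1}{n-1}\log\bigl(1-x^{(\Lambda)}_{n-1,n}\bigr)=-\log 4$$ and $$\lim_{n\to\infty}\frac{1}{n-1}\log\bigl(1-x^{(\Xi)}_{n-1,n}\bigr)=-\log 9.$$
   Context: For $m\ge 1$, $A_m(z)$ denotes the Eulerian polynomial of type A, normalized to have constant term $1$: $A_m(z)=\sum_{\sigma\in S_m}z^{\operatorname{des}(\sigma)}$, where $\operatorname{des}(\sigma)$ is the number of descents of the permutation $\sigma$ of $\{1,\dots,m\}$; it has degree $m-1$. $B_m(z)$ denotes the Eulerian polynomial of type B, i.e. the polynomial of degree $m$ determined by $$\sum_{k=0}^{\infty}(2k+1)^m z^k=\frac{B_m(z)}{(1-z)^{m+1}},\qquad |z|<1.$$ For $n\ge 1$, $\Xi_n$ and $\Lambda_n$ are the polynomials given by $$\Xi_n(t)=\frac{(-1)^{n+1}}{2^{4n-1}(2n-1)!}\,\frac{(1+t)^{2n-1}}{t}\,B_{2n-1}\!\left(-\frac{1-t}{1+t}\right),$$ $$\Lambda_n(t)=\frac{(-1)^{n+1}}{(2^{2n+1}-1)(2n)!}\,\frac{(1+t)^{2n-1}}{t}\,A_{2n}\!\left(-\frac{1-t}{1+t}\right).$$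 The right-hand sides are polynomials in $t$ (after removing the removable singularities at $t=0$ and $t=-1$), and these polynomials are even. Put $\widetilde{\Xi}_n(x):=\Xi_n(\sqrt{x})$ and $\widetilde{\Lambda}_n(x):=\Lambda_n(\sqrt{x})$; that is, $\widetilde{\Xi}_n$ and $\widetilde{\Lambda}_n$ are the polynomials with $\Xi_n(t)=\widetilde{\Xi}_n(t^2)$ and $\Lambda_n(t)=\widetilde{\Lambda}_n(t^2)$. It is known that $\widetilde{\Xi}_n$ and $\widetilde{\Lambda}_n$ have degree $n-1$ and that all their zeros are real, simple, and contained in $(0,1)$, so the zeros can be listed in increasing order as in the claim. *)

(* Defs.v *)
From HB Require Import structures.
From mathcomp Require Import all_boot all_order all_fingroup all_algebra.
From mathcomp Require Import boolp classical_sets functions reals.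
From mathcomp Require Import topology normedtype sequences exp.
From mathcomp Require Import ring lra zify.

Set Implicit Arguments.
Unset Strict Implicit.
Unset Printing Implicit Defensive.
Import Order.TTheory GRing.Theory Num.Theory.
Import numFieldNormedType.Exports.
Local Open Scope classical_set_scope.
Local Open Scope ring_scope.

Definition des (m : nat) (s : 'S_m) : nat :=
  #|[pred i : 'I_m | [exists j : 'I_m, (j == i.+1 :> nat) && (s j < s i)%N]]|.

Definition eulerianA (R : realType) (m : nat) : {poly R} :=
  \sum_(s : 'S_m) 'X^(des s).

(* Restricting the expansion to real z loses nothing: it already determines p,
   see is_eulerianB_unique. *)
Definition is_eulerianB (R : realType) (m : nat) (p : {poly R}) : Prop :=
  size p = m.+1 /\
  forall z : R, `|z| < 1 ->
    series (fun k : nat => (2 * k + 1)%:R ^+ m * z ^+ k) @ \oo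
      --> p.[z] / (1 - z) ^+ m.+1.

Definition eulerianB (R : realType) (m : nat) : {poly R} :=
  xget 0 [set p | is_eulerianB m p].

(* t = 0 and t = -1 are the removable singularities of the right-hand sides. *)
Definition is_Xi (R : realType) (n : nat) (p : {poly R}) : Prop :=
  forall t : R, t != 0 -> t != -1 ->
    p.[t] = (-1) ^+ n.+1 / (2 ^+ (4 * n - 1) * (2 * n - 1)`!%:R)
            * ((1 + t) ^+ (2 * n - 1) / t)
            * (eulerianB R (2 * n - 1)).[- ((1 - t) / (1 + t))].

Definition Xi (R : realType) (n : nat) : {poly R} :=
  xget 0 [set p | is_Xi n p].

Definition is_Lambda (R : realType) (n : nat) (p : {poly R}) : Prop :=
  forall t : R, t != 0 -> t != -1 ->
    p.[t] = (-1) ^+ n.+1 / ((2 ^+ (2 * n + 1) - 1) * (2 * n)`!%:R)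
            * ((1 + t) ^+ (2 * n - 1) / t)
            * (eulerianA R (2 * n)).[- ((1 - t) / (1 + t))].

Definition Lambda (R : realType) (n : nat) : {poly R} :=
  xget 0 [set p | is_Lambda n p].

Definition tilde (R : realType) (p : {poly R}) : {poly R} :=
  xget 0 [set q : {poly R} | forall t : R, p.[t] = q.[t ^+ 2]].

Definition XiT (R : realType) (n : nat) : {poly R} := tilde (Xi R n).
Definition LambdaT (R : realType) (n : nat) : {poly R} := tilde (Lambda R n).

(* x 1 < ... < x d are the zeros of p, all lying in (0, 1); the values of x
   outside of 1, ..., d are irrelevant. *)
Definition zeros_in01 (R : realType) (p : {poly R}) (d : nat) (x : nat -> R)
    : Prop :=
  [/\ forall k, (1 <= k <= d)%N -> 0 < x k < 1,
      forall k, (1 <= k)%N -> (k < d)%N -> x k < x k.+1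
    & forall y : R, root p y <-> exists2 k, (1 <= k <= d)%N & y = x k].

(* The rest of the file shows that the polynomials introduced above by xget
   exist: eulerianBP, XiP, LambdaP, XiTP and LambdaTP give their defining
   properties. *)

Lemma natX_geometric_cvg0 (R : realType) (i : nat) (w : R) : 0 <= w -> w < 1 ->
  (fun N : nat => N%:R ^+ i * w ^+ N) @ \oo --> (0 : R).
Proof.
elim: i w => [|i IH] w w0 w1.
  under eq_fun do rewrite expr0 mul1r.
  by apply: cvg_expr; rewrite ger0_norm.
pose s := Num.sqrt w.
have s0 : 0 <= s by exact: sqrtr_ge0.
have sE : w = s * s by rewrite -expr2 sqr_sqrtr.
have s1 : s < 1.
  by rewrite ltNge; apply/negP => h; move: w1; rewrite sE; nra.
have bnd (N : nat) : N%:R * s ^+ N <= (1 - s)^-1.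
  have d0 : 0 < 1 - s by lra.
  rewrite -[leRHS]mul1r ler_pdivlMr //.
  have -> : N%:R * s ^+ N = \sum_(k < N) s ^+ N.
    by rewrite sumr_const card_ord mulr_natl.
  apply: (@le_trans _ _ ((\sum_(k < N) s ^+ k) * (1 - s))).
    apply: ler_wpM2r; first exact: ltW.
    by apply: ler_sum => k _; apply: ler_wiXn2l => //; [exact: ltW | exact: ltnW (ltn_ord k)].
  rewrite mulrC -opprB mulNr -subrX1 opprB.
  by rewrite lerBlDr lerDl exprn_ge0.
apply: (@squeeze_cvgr _ _ _ _ (fun=> 0) (fun N => N%:R ^+ i * s ^+ N * (1 - s)^-1)).
- apply: nearW => N; apply/andP; split.
    by apply: mulr_ge0; apply: exprn_ge0.
  have -> : N%:R ^+ i.+1 * w ^+ N = (N%:R ^+ i * s ^+ N) * (N%:R * s ^+ N).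
    by rewrite sE exprMn exprS; ring.
  by apply: ler_wpM2l => //; apply: mulr_ge0; apply: exprn_ge0.
- exact: cvg_cst.
- rewrite -[X in _ --> X](mul0r (1 - s)^-1).
  apply: cvgM; [exact: IH | exact: cvg_cst].
Qed.

Fixpoint recB (R : realType) (m : nat) : {poly R} :=
  if m is m'.+1 then
    (1 + (2 * m' + 1)%:R *: 'X) * recB R m'
    + 2 *: 'X * (1 - 'X) * (recB R m')^`()
  else 1.

Lemma coef_recBS (R : realType) (m k : nat) : (recB R m.+1)`_k =
  (2 * k + 1)%:R * (recB R m)`_k +
  (if k is j.+1 then ((2 * m + 1)%:R - (2 * j)%:R) * (recB R m)`_j else 0).
Proof.
rewrite [recB R m.+1]/=.
have -> : (1 + (2 * m + 1)%:R *: 'X) * recB R m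
    + 2 *: 'X * (1 - 'X) * (recB R m)^`() =
  recB R m + (2 * m + 1)%:R *: (recB R m * 'X)
  + 2 *: ((recB R m)^`() * 'X) - 2 *: ((recB R m)^`() * 'X * 'X).
  by rewrite -!mul_polyC; ring.
rewrite !coefD coefN !coefZ !coefMX !coef_deriv.
move: (recB R m) => b; case: k => [|[|k]] /=.
- by rewrite !mulr0 !addr0 subr0 mul1r.
- move: b`_1 b`_0 => u v; rewrite mulr1n !natrD !natrM; ring.
- move: b`_k.+2 b`_k.+1 => u v.
  rewrite -(mulr_natr u) -(mulr_natr v) !natrD !natrM -(natr1 k.+1) -(natr1 k).
  by move: (k%:R) (m%:R) => x y; ring.
Qed.

Lemma recB_pal (R : realType) (m : nat) :
  [/\ (recB R m)`_0 = 1, (forall k, (m < k)%N -> (recB R m)`_k = 0)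
   & forall k, (k <= m)%N -> (recB R m)`_(m - k) = (recB R m)`_k].
Proof.
elim: m => [|m [h0 hs hp]].
  split=> [|[|k]|[|k]] //; by rewrite /= coefC.
have top : (recB R m)`_m = 1 by rewrite -[RHS]h0 -(hp 0) ?subn0.
split.
- by rewrite coef_recBS h0 /=; ring.
- move=> [|k] // km; rewrite ltnS in km.
  by rewrite coef_recBS (hs k) // (hs k.+1) ?mulr0 ?addr0 // ltnW.
- move=> [|k] km.
    rewrite subn0 !coef_recBS (hs m.+1) // top h0; ring.
  rewrite subSS; rewrite ltnS in km.
  rewrite !coef_recBS hp //.
  move: (km); rewrite leq_eqVlt => /orP[/eqP ->|km'].
    by rewrite subnn (hs m.+1) // top; ring.
  have -> : (m - k)%N = (m - k.+1).+1 by rewrite -subnSK.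
  rewrite (hp k.+1) //.
  have -> : ((2 * (m - k.+1).+1 + 1)%:R : R) = (2 * m + 1)%:R - (2 * k)%:R.
    rewrite -natrB; last by lia.
    by congr (_%:R); lia.
  have -> : ((2 * m + 1)%:R - (2 * (m - k.+1))%:R : R) = (2 * k.+1 + 1)%:R.
    rewrite -natrB; last by lia.
    by congr (_%:R); lia.
  by ring.
Qed.

Lemma size_recB (R : realType) (m : nat) : size (recB R m) = m.+1.
Proof.
have [h0 hs hp] := recB_pal R m.
apply/eqP; rewrite eqn_leq; apply/andP; split.
  by apply/leq_sizeP => k; exact: hs.
rewrite ltnNge; apply/negP => /leq_sizeP /(_ m (leqnn m)) h.
have := hp 0%N (leq0n m); rewrite subn0 h h0 => /esym/eqP.
by rewrite oner_eq0.
Qed.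

Lemma recB_remainder (R : realType) (m : nat) : exists r : {poly {poly R}},
  forall N : nat,
    (1 - 'X) ^+ m.+1 * \sum_(k < N) (2 * k + 1)%:R ^+ m *: 'X^k
    = recB R m + 'X^N * r.[N%:R%:P].
Proof.
elim: m => [|m [r IH]].
  exists (- 1) => N.
  have -> : \sum_(k < N) (2 * k + 1)%:R ^+ 0 *: ('X^k : {poly R})
    = \sum_(k < N) 'X^k by apply: eq_bigr => k _; rewrite expr0 scale1r.
  rewrite hornerN hornerC expr1 -opprB mulNr -subrX1 /=; ring.
pose D := map_poly (fun p : {poly R} => p^`()) r.
have DE (c : R) : D.[c%:P] = (r.[c%:P])^`().
  rewrite (@horner_coef_wide _ (size r)) ?size_poly //.
  rewrite horner_coef raddf_sum; apply: eq_bigr => i _.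
  rewrite coef_map_id0 ?linear0 // -polyC_exp mulrC mul_polyC.
  by rewrite [in RHS]mulrC mul_polyC /= derivZ.
exists (((1 - 'X) + (2 * m.+1)%:R *: 'X)%:P * r
        + 2 *: ((1 - 'X)%:P * ('X * r)) + (2 *: ('X * (1 - 'X)))%:P * D) => N.
have := IH N; set S := \sum_(k < N) _ => IHN.
have XD (k : nat) : 'X * ('X^k : {poly R})^`() = k%:R *: 'X^k.
  case: k => [|k]; first by rewrite expr0 derivC mulr0 scale0r.
  by rewrite derivXn mulrnAr -exprS scaler_nat.
have -> : \sum_(k < N) (2 * k + 1)%:R ^+ m.+1 *: 'X^k = S + 2 *: ('X * S^`()).
  rewrite raddf_sum mulr_sumr scaler_sumr -big_split /=.
  apply: eq_bigr => k _; rewrite derivZ -scalerAr XD exprS !scalerA -scalerDl.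
  by congr (_ *: _); rewrite natrD natrM; ring.
have /(congr1 (fun p : {poly R} => (1 - 'X) * ('X * p^`()))) := IHN.
rewrite derivM derivD derivM deriv_exp derivB derivX derivC /= => IHD.
have {}IHD : (1 - 'X) ^+ m.+2 * ('X * S^`()) =
    (1 - 'X) * 'X * (recB R m)^`()
    + (1 - 'X) * ('X * ('X^N)^`()) * r.[N%:R%:P]
    + (1 - 'X) * 'X * 'X^N * (r.[N%:R%:P])^`()
    + m.+1%:R * 'X * ((1 - 'X) ^+ m.+1 * S).
  apply/eqP; rewrite -subr_eq0; apply/eqP.
  move/eqP: IHD; rewrite -subr_eq0 => /eqP <-.
  by rewrite -mulr_natr exprSr [_ ^+ m.+1]exprSr; ring.
rewrite XD IHN in IHD.
rewrite mulrDr [in X in X + _]exprS -mulrA IHN -scalerAr IHD.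
rewrite !hornerE DE /= -!mul_polyC !polyC_natr.
rewrite natrD !natrM -(natr1 m).
by ring.
Qed.

Lemma poly_natX_cvg0 (R : realType) (r : {poly {poly R}}) (z : R) : `|z| < 1 ->
  (fun N : nat => z ^+ N * (r.[N%:R%:P]).[z]) @ \oo --> (0 : R).
Proof.
move=> z1.
have -> : (fun N : nat => z ^+ N * (r.[N%:R%:P]).[z]) =
    (fun N => \sum_(i < size r) (r`_i).[z] * (N%:R ^+ i * z ^+ N)).
  apply/funext => N; rewrite (horner_coef r) horner_sum mulr_sumr.
  by apply: eq_bigr => i _; rewrite hornerM -polyC_exp hornerC; ring.
elim: (index_enum 'I_(size r)) => [|i e IHe].
  by under eq_fun do rewrite big_nil; exact: cvg_cst.
have ih : (fun N : nat => (r`_i).[z] * (N%:R ^+ i * z ^+ N)) @ \oo --> (0 : R).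
  rewrite -[X in _ --> X](mulr0 (r`_i).[z]).
  apply: cvgM; first exact: cvg_cst.
  apply: norm_cvg0.
  under eq_fun do rewrite normrM !normrX normr_nat.
  exact: natX_geometric_cvg0.
have := cvgD ih IHe; rewrite addr0.
by move=> h; under eq_fun do rewrite big_cons; exact: h.
Qed.

Lemma is_eulerianB_recB (R : realType) (m : nat) : is_eulerianB m (recB R m).
Proof.
split; first exact: size_recB.
move=> z z1; have [r IH] := recB_remainder R m.
have d0 : 1 - z != 0.
  by rewrite subr_eq0; apply/eqP => h; move: z1; rewrite -h normr1 ltxx.
have -> : series (fun k : nat => (2 * k + 1)%:R ^+ m * z ^+ k) =
   (fun N => ((recB R m).[z] + z ^+ N * (r.[N%:R%:P]).[z]) * ((1 - z) ^+ m.+1)^-1).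
  apply/funext => N; apply/eqP; rewrite -[_ == _](inj_eq (mulIf (expf_neq0 m.+1 d0))).
  rewrite mulfVK ?expf_neq0 //; apply/eqP.
  have := congr1 (fun p : {poly R} => p.[z]) (IH N).
  rewrite !(hornerE, horner_exp) /= => <-; rewrite mulrC; congr (_ * _).
  rewrite /series /= big_mkord horner_sum; apply: eq_bigr => k _.
  by rewrite !hornerE.
apply: cvgM; last exact: cvg_cst.
rewrite -[X in _ --> X]addr0; apply: cvgD; first exact: cvg_cst.
exact: poly_natX_cvg0.
Qed.

Lemma poly_eq_near0 (R : realType) (p q : {poly R}) :
  (forall t, 0 < t < 1 -> p.[t] = q.[t]) -> p = q.
Proof.
move=> pq; apply/eqP; rewrite -subr_eq0; apply: contraT => nz.
pose s := [seq (k.+2%:R^-1 : R) | k <- iota 0 (size (p - q))].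
have /(max_poly_roots nz) : all (root (p - q)) s.
  apply/allP => _ /mapP[k _ ->]; rewrite rootE !hornerE pq ?subrr //.
  by rewrite invr_gt0 ltr0n /= invf_lt1 ?ltr0n // ltr1n.
rewrite size_map size_iota ltnn => h; apply: h.
rewrite map_inj_uniq ?iota_uniq // => i j /invr_inj/eqP.
by rewrite eqr_nat => /eqP[].
Qed.

Lemma is_eulerianB_unique (R : realType) (m : nat) (p q : {poly R}) :
  is_eulerianB m p -> is_eulerianB m q -> p = q.
Proof.
move=> [_ hp] [_ hq]; apply: poly_eq_near0 => t /andP[t0 t1].
have nt : `|t| < 1 by rewrite gtr0_norm.
have e := cvg_unique (@norm_hausdorff _ _) (hp t nt) (hq t nt).
have nz : ((1 - t) ^+ m.+1)^-1 != 0.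
  by rewrite invr_eq0 expf_neq0 // subr_eq0 gt_eqF.
exact: (mulIf nz (e _)).
Qed.

Lemma eulerianBP (R : realType) (m : nat) : is_eulerianB m (eulerianB R m).
Proof. by apply: (@xgetPex _ 0); exists (recB R m); exact: is_eulerianB_recB. Qed.

Lemma eulerianBE (R : realType) (m : nat) : eulerianB R m = recB R m.
Proof. exact: is_eulerianB_unique (eulerianBP R m) (is_eulerianB_recB R m). Qed.

Lemma des_rev (d : nat) (s : 'S_d.+1) :
  (des s + des (s * perm (@rev_ord_inj d.+1)) = d)%N.
Proof.
rewrite /des -cardUI; set D := [pred i | _]; set D' := [pred i | _].
have mem' i : (i \in D') = [exists j : 'I_d.+1, (j == i.+1 :> nat) && (s i < s j)%N].
  rewrite inE; apply: eq_existsb => j; congr (_ && _).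
  rewrite !permM !permE /=; have := ltn_ord (s i); have := ltn_ord (s j); lia.
rewrite [X in (_ + X)%N]eq_card0; last first.
  move=> i; rewrite inE mem' !inE; apply/negP => /andP[].
  move=> /existsP[j /andP[/eqP ji lt1]] /existsP[j' /andP[/eqP ji' lt2]].
  have jj : j' = j by apply/val_inj; rewrite /= ji ji'.
  by move: lt1 lt2; rewrite jj; lia.
rewrite addn0 (@eq_card _ _ (predC1 ord_max)) ?cardC1 ?card_ord // => i.
  rewrite inE mem' !inE.
  apply/idP/idP.
    case/orP => /existsP[j /andP[/eqP ji _]]; apply/eqP => iE.
      by have := ltn_ord j; rewrite ji iE ltnn.
    by have := ltn_ord j; rewrite ji iE ltnn.
  move=> im; have id : (i.+1 < d.+1)%N.
    rewrite ltn_neqAle ltn_ord andbT; apply: contra im => /eqP[iE].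
    by apply/eqP/val_inj.
  have : s (Ordinal id) != s i.
    by rewrite (inj_eq perm_inj) -val_eqE /= gtn_eqF.
  rewrite -val_eqE neq_ltn => /orP[lt|lt]; apply/orP; [left|right];
    by apply/existsP; exists (Ordinal id); rewrite eqxx.
Qed.

Lemma eulerianA_pal (R : realType) (d : nat) :
  (size (eulerianA R d.+1) <= d.+1)%N /\
  forall k, (k <= d)%N -> (eulerianA R d.+1)`_(d - k) = (eulerianA R d.+1)`_k.
Proof.
have desle (s : 'S_d.+1) : (des s <= d)%N by have := des_rev s; lia.
split.
  apply/leq_sizeP => k dk; rewrite coef_sum big1 // => s _.
  by rewrite coefXn gtn_eqF // (leq_ltn_trans (desle s)).
move=> k kd; rewrite !coef_sum.
rewrite (reindex_inj (mulIg (perm (@rev_ord_inj d.+1)))) /=.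
apply: eq_bigr => s _; rewrite !coefXn; congr (nat_of_bool _)%:R.
by have := des_rev s; have := desle s; move: (des _) (des s) => a b h1 h2; lia.
Qed.

Lemma palindromic_odd (R : realType) (d : nat) (p : {poly R}) :
  odd d -> (size p <= d.+1)%N ->
  (forall k, (k <= d)%N -> p`_(d - k) = p`_k) ->
  exists q : {poly R}, forall t, t != 0 -> t != -1 ->
    q.[t ^+ 2] = (1 + t) ^+ d / t * p.[- ((1 - t) / (1 + t))].
Proof.
move=> od sp pp.
pose h := \sum_(k < d.+1) p`_k *: (('X - 1) ^+ k * (1 + 'X) ^+ (d - k)).
have hE t : h.[t] = \sum_(k < d.+1) p`_k * ((t - 1) ^+ k * (1 + t) ^+ (d - k)).
  by rewrite horner_sum; apply: eq_bigr => k _; rewrite !(hornerE, horner_exp).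
have hN t : h.[- t] = - h.[t].
  rewrite !hE (reindex_inj rev_ord_inj) /= -sumrN; apply: eq_bigr => k _.
  have kd : (k <= d)%N by rewrite -ltnS.
  rewrite subSS pp // subKn // -mulrN; congr (_ * _).
  have -> : - t - 1 = - (1 + t) by ring.
  have -> : 1 + - t = - (t - 1) by ring.
  rewrite [in LHS]exprNn [X in _ * X]exprNn.
  have -> : (-1) ^+ (d - k) * (1 + t) ^+ (d - k) * ((-1) ^+ k * (t - 1) ^+ k)
    = ((-1) ^+ (d - k) * (-1) ^+ k) * ((t - 1) ^+ k * (1 + t) ^+ (d - k)) by ring.
  by rewrite -exprD subnK // -signr_odd od mulN1r.
exists (odd_poly h) => t t0 t1.
have t1' : 1 + t != 0 by rewrite addrC addr_eq0.
have split u : h.[u] = (even_poly h).[u ^+ 2] + (odd_poly h).[u ^+ 2] * u.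
  by rewrite -{1}(poly_even_odd h) !(hornerE, horner_comp).
have ev0 : (even_poly h).[t ^+ 2] = 0.
  have := hN t; rewrite (split t) (split (- t)) sqrrN; lra.
have := split t; rewrite ev0 add0r => e.
rewrite -[LHS](mulfK t0) -e hE (horner_coef_wide _ sp) [RHS]mulrAC.
congr (_ / _); rewrite mulr_sumr; apply: eq_bigr => k _.
have kd : (k <= d)%N by rewrite -ltnS.
have -> : (1 + t) ^+ d = (1 + t) ^+ (d - k) * (1 + t) ^+ k.
  by rewrite -exprD subnK.
have -> : - ((1 - t) / (1 + t)) = (t - 1) / (1 + t) by rewrite -mulNr opprB.
rewrite expr_div_n.
have e1 : (1 + t) ^+ k != 0 by rewrite expf_neq0.
by field.
Qed.

Lemma is_Xi_even (R : realType) (n : nat) : (1 <= n)%N ->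
  exists q : {poly R}, is_Xi n (q \Po 'X^2).
Proof.
move=> n1; have [_ _ pp] := recB_pal R (2 * n - 1).
have od : odd (2 * n - 1) by lia.
have sz : (size (recB R (2 * n - 1)) <= (2 * n - 1).+1)%N by rewrite size_recB.
have [q hq] := palindromic_odd od sz pp.
exists (((-1) ^+ n.+1 / (2 ^+ (4 * n - 1) * (2 * n - 1)`!%:R)) *: q) => t t0 t1.
by rewrite eulerianBE horner_comp hornerXn hornerZ hq // mulrA.
Qed.

Lemma is_Lambda_even (R : realType) (n : nat) : (1 <= n)%N ->
  exists q : {poly R}, is_Lambda n (q \Po 'X^2).
Proof.
move=> n1; have e : (2 * n = (2 * n - 1).+1)%N by lia.
have [sz pp] := eulerianA_pal R (2 * n - 1).
have od : odd (2 * n - 1) by lia.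
have [q hq] := palindromic_odd od sz pp.
rewrite -e in hq.
exists (((-1) ^+ n.+1 / ((2 ^+ (2 * n + 1) - 1) * (2 * n)`!%:R)) *: q) => t t0 t1.
by rewrite horner_comp hornerXn hornerZ hq // mulrA.
Qed.

Lemma XiP (R : realType) (n : nat) : (1 <= n)%N -> is_Xi n (Xi R n).
Proof.
move=> n1; have [q hq] := is_Xi_even R n1.
by apply: (@xgetPex _ 0); exists (q \Po 'X^2).
Qed.

Lemma LambdaP (R : realType) (n : nat) : (1 <= n)%N -> is_Lambda n (Lambda R n).
Proof.
move=> n1; have [q hq] := is_Lambda_even R n1.
by apply: (@xgetPex _ 0); exists (q \Po 'X^2).
Qed.

Lemma XiTP (R : realType) (n : nat) (t : R) : (1 <= n)%N ->
  (Xi R n).[t] = (XiT R n).[t ^+ 2].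
Proof.
move=> n1; have [q hq] := is_Xi_even R n1.
have e : Xi R n = q \Po 'X^2.
  apply: poly_eq_near0 => u /andP[u0 _].
  by rewrite XiP ?hq ?gt_eqF // (lt_trans _ u0) ?ltrN10.
move: t; apply: (@xgetPex _ 0 [set q : {poly R} | forall t : R, _ = q.[t ^+ 2]]).
by exists q => t; rewrite e horner_comp hornerXn.
Qed.

Lemma LambdaTP (R : realType) (n : nat) (t : R) : (1 <= n)%N ->
  (Lambda R n).[t] = (LambdaT R n).[t ^+ 2].
Proof.
move=> n1; have [q hq] := is_Lambda_even R n1.
have e : Lambda R n = q \Po 'X^2.
  apply: poly_eq_near0 => u /andP[u0 _].
  by rewrite LambdaP ?hq ?gt_eqF // (lt_trans _ u0) ?ltrN10.
move: t; apply: (@xgetPex _ 0 [set q : {poly R} | forall t : R, _ = q.[t ^+ 2]]).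
by exists q => t; rewrite e horner_comp hornerXn.
Qed.

(* Main.v *)
(* Let q be one of the two polynomials with d = 2n - 1, and p the Eulerian
   polynomial (B_d or A_{d+1}) it comes from, so that
   q(t^2) = c (1 + t)^d / t * p(-(1 - t) / (1 + t)). Since q has degree n - 1 and
   n - 1 distinct zeros x_k, taking logarithmic derivatives at t = 1 gives
     sum_k 1 / (1 - x_k) = q'(1) / q(1) = (d + p_1 - 2) / 4,
   where p_1 is the coefficient of z in p: 3^d - d - 1 for B_d and
   2^(d+1) - (d+1) - 1 for A_{d+1}. All the terms are positive, so the largest
   one, 1 / (1 - x_{n-1}), lies between the sum divided by n - 1 and the sum;
   the sum is of order 9^(n-1), respectively 4^(n-1).
   The coefficient of A_m is found by listing a subset of {1, ..., m}
   increasingly and then its complement: this maps the 2^m subsets to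
   permutations with at most one descent, hitting the identity m + 1 times and
   each permutation with exactly one descent once. *)

Require Import Defs.
From mathcomp Require Import all_boot all_order all_fingroup all_algebra.
From mathcomp Require Import boolp classical_sets functions reals.
From mathcomp Require Import topology normedtype sequences exp.
From mathcomp Require Import ring lra zify.
Import Order.TTheory GRing.Theory Num.Theory.
Import numFieldNormedType.Exports.
Local Open Scope nat_scope.

(** * Counting permutations with at most one descent by subsets *)

(* All descents of [s] lie between the positions [k.-1] and [k]. *)
Definition ascends_off (m k : nat) (s : 'S_m) : bool :=
  [forall i : 'I_m, forall j : 'I_m,
     (j == i.+1 :> nat) && (j != k :> nat) ==> (s i < s j)].

Definition ltn_ord_rel (m : nat) : rel 'I_m := fun i j => (i < j).

Lemma enum_set_sorted (m : nat) (S : {set 'I_m}) :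
  sorted (ltn_ord_rel m) (enum S).
Proof.
rewrite /enum_mem; apply: sorted_filter; first by move=> i j k; exact: ltn_trans.
rewrite -enumT -(sorted_map (f := val) (e' := ltn)) val_enum_ord.
exact: iota_ltn_sorted.
Qed.

Definition perm_word (m : nat) (s : 'S_m) : seq 'I_m := [seq s i | i <- enum 'I_m].

Lemma size_perm_word (m : nat) (s : 'S_m) : size (perm_word m s) = m.
Proof. by rewrite size_map size_enum_ord. Qed.

Lemma nth_perm_word (m : nat) (s : 'S_m) (i0 i : 'I_m) :
  nth i0 (perm_word m s) i = s i.
Proof. by rewrite (nth_map i0) ?size_enum_ord // nth_ord_enum. Qed.

Lemma perm_word_inj (m : nat) : injective (perm_word m).
Proof.
move=> s s' e; apply/permP => i.
by rewrite -(nth_perm_word m s i) e nth_perm_word.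
Qed.

Definition block_word (m : nat) (S : {set 'I_m}) : seq 'I_m :=
  enum S ++ enum (~: S).

Lemma block_perm_exists (m : nat) (S : {set 'I_m}) :
  exists s : 'S_m, perm_word m s == block_word m S.
Proof.
have : perm_eq (block_word m S) (ord_tuple m).
  apply: uniq_perm.
  - rewrite cat_uniq !enum_uniq andbT; apply/hasPn => i.
    by rewrite !mem_enum inE.
  - by rewrite val_ord_tuple enum_uniq.
  - by move=> i; rewrite val_ord_tuple mem_cat !mem_enum !inE orbN.
move=> /tuple_permP[s e]; exists s; apply/eqP; rewrite e.
by apply: eq_map => i; rewrite tnth_ord_tuple.
Qed.

Definition block_perm (m : nat) (S : {set 'I_m}) : 'S_m :=
  xchoose (block_perm_exists m S).

Lemma perm_word_block_perm (m : nat) (S : {set 'I_m}) :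
  perm_word m (block_perm m S) = block_word m S.
Proof. exact/eqP/(xchooseP (block_perm_exists m S)). Qed.

Lemma block_permE (m : nat) (S : {set 'I_m}) (i0 i : 'I_m) :
  block_perm m S i =
  if (i < #|S|) then nth i0 (enum S) i else nth i0 (enum (~: S)) (i - #|S|).
Proof.
by rewrite -(nth_perm_word m _ i0) perm_word_block_perm nth_cat -cardE.
Qed.

(** [enum] lists a set in increasing order, so consecutive values grow inside either block; only the
    junction at position [#|S|] can be a descent. *)
Lemma block_perm_ascends (m : nat) (S : {set 'I_m}) :
  ascends_off m #|S| (block_perm m S).
Proof.
apply/forallP => i; apply/forallP => j; apply/implyP => /andP[/eqP ji jk].
rewrite !(block_permE m S i) ji; rewrite ji in jk.
have jm := ltn_ord j; rewrite ji in jm.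
have cS : (#|S| + #|~: S| = m) by rewrite cardsC card_ord.
have [lt1|ge1] := ltnP i.+1 #|S|.
  have -> : (i < #|S|) by lia.
  have /sortedP := enum_set_sorted m S; move=> /(_ i i).
  by rewrite -cardE; exact.
have -> : (i < #|S|) = false by lia.
have /sortedP := enum_set_sorted m (~: S); move=> /(_ i (i - #|S|)).
rewrite -cardE subSn; last by lia.
apply; move: cS ge1 jk jm; move: #|S| #|~: S| (nat_of_ord i) => a b c; lia.
Qed.

Lemma card_ord_lt (m k : nat) : (k <= m) -> #|[set i : 'I_m | (i < k)]| = k.
Proof.
move=> km; rewrite -sum1dep_card.
by rewrite (big_ord_narrow km) sum1_card card_ord.
Qed.

(** The first [#|S|] values lie in [S], and by injectivity there are as many of them as elements of
    [S]. Hence [S] can be read off from the permutation and the cut. *)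
Lemma block_perm_image (m : nat) (S : {set 'I_m}) :
  [set block_perm m S i | i : 'I_m & (i < #|S|)] = S.
Proof.
apply/eqP; rewrite eqEcard; apply/andP; split.
  apply/fintype.subsetP => y /imsetP[i]; rewrite inE => iS ->.
  rewrite (block_permE m S i) iS -mem_enum mem_nth // -cardE //.
rewrite card_imset; last exact: perm_inj.
by rewrite card_ord_lt // -[leqRHS]card_ord max_card.
Qed.

(** A valid cut splits the word of [s] into two increasing pieces, and an increasing word is
    determined by its set of letters. *)
Lemma ascends_block_perm (m k : nat) (s : 'S_m) : (k <= m) ->
  ascends_off m k s -> block_perm m [set s i | i : 'I_m & (i < k)] = s.
Proof.
case: m s => [|m] s km asc; first by apply/permP => -[].
set S := (X in block_perm _ X).
have sz := size_perm_word m.+1 s.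
have ltr : transitive (ltn_ord_rel m.+1) by move=> i j l; exact: ltn_trans.
have lir : irreflexive (ltn_ord_rel m.+1) by move=> i; exact: ltnn.
have step (a : nat) : (a < m) -> a.+1 != k ->
    ltn_ord_rel m.+1 (nth ord0 (perm_word m.+1 s) a)
                     (nth ord0 (perm_word m.+1 s) a.+1).
  move=> am ak; have am' : (a < m.+1) by lia.
  rewrite (nth_perm_word _ s ord0 (Ordinal am')).
  rewrite (nth_perm_word _ s ord0 (Ordinal (am : a.+1 < m.+1))).
  have /forallP/(_ (Ordinal am'))/forallP/(_ (Ordinal (am : a.+1 < m.+1))) := asc.
  by rewrite /= eqxx ak.
have mem_take y : (y \in take k (perm_word m.+1 s)) = (y \in S).
  apply/idP/imsetP.
    move=> /(nthP y)[a]; rewrite size_takel ?sz // => ak.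
    have am : (a < m.+1) by lia.
    rewrite nth_take // (nth_perm_word _ s y (Ordinal am)) => <-.
    by exists (Ordinal am); rewrite ?inE.
  move=> [i]; rewrite inE => ik ->; apply/(nthP i).
  by exists i; rewrite ?size_takel ?sz // nth_take // nth_perm_word.
apply: perm_word_inj; rewrite perm_word_block_perm.
rewrite -(cat_take_drop k (perm_word m.+1 s)).
congr (_ ++ _); apply: (irr_sorted_eq ltr lir); rewrite ?enum_set_sorted //.
- apply/(sortedP ord0) => a; rewrite size_takel ?sz // => ak.
  by rewrite !nth_take //; [apply: step | ]; lia.
- by move=> y; rewrite mem_take mem_enum.
- apply/(sortedP ord0) => a; rewrite size_drop ?sz // => ak.
  by rewrite !nth_drop addnS; apply: step; lia.
(* Each letter occurs exactly once in the word of [s], so the letters after the cut are those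
   missing before it. *)
- move=> y; rewrite mem_enum inE -mem_take.
  have : y \in perm_word m.+1 s by rewrite -(permKV s y) map_f // mem_enum.
  have : uniq (perm_word m.+1 s).
    by rewrite map_inj_uniq ?enum_uniq //; exact: perm_inj.
  rewrite -{1 2}(cat_take_drop k (perm_word m.+1 s)) cat_uniq mem_cat.
  move=> /and3P[_ /hasPn disj _].
  have [/disj -> //|_] := boolP (y \in drop k _).
  by rewrite orbF => ->.
Qed.

(** A set in the fiber is determined by its size [k]: it is the image of the first [k] positions,
    and [k] is a valid cut. Conversely every valid cut yields such a set, and distinct cuts yield
    sets of distinct sizes. *)
Lemma card_block_perm_fiber (m : nat) (s : 'S_m) :
  #|[set S : {set 'I_m} | block_perm m S == s]| =
  #|[set k : 'I_m.+1 | ascends_off m k s]|.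
Proof.
pose im (k : 'I_m.+1) := [set s i | i : 'I_m & (i < k)].
have card_im (k : 'I_m.+1) : #|im k| = k.
  rewrite card_imset; last exact: perm_inj.
  by rewrite card_ord_lt // -ltnS.
have im_inj : injective im.
  by move=> k k' e; apply: val_inj; rewrite /= -card_im e card_im.
rewrite -(card_imset _ im_inj); apply: eq_card => S.
rewrite inE; apply/eqP/imsetP.
  move=> sE; have Sm : #|S| < m.+1.
    by rewrite ltnS -[leqRHS]card_ord max_card.
  exists (Ordinal Sm); first by rewrite inE /= -sE block_perm_ascends.
  by rewrite /im /= -sE block_perm_image.
by move=> [k]; rewrite inE => asc ->; apply: ascends_block_perm; rewrite // -ltnS.
Qed.

(* The fiber of [block_perm] over [s] is counted by the cut points [k]: any of
   the [m.+1] ones if [s] has no descent, only the descent if it has one. *)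
Lemma card_ascends_off (m : nat) (s : 'S_m) :
  #|[set k : 'I_m.+1 | ascends_off m k s]| =
  ((des s == 0) * m.+1 + (des s == 1)).
Proof.
rewrite /des; set D := [pred i | _].
have offP (k : nat) : ascends_off m k s = [forall i in D, k == i.+1].
  apply/forallP/forall_inP => [h i|h i].
    rewrite inE => /existsP[j /andP[/eqP ji lt]].
    have /forallP/(_ j) := h i; rewrite ji eqxx /= => /implyP.
    by rewrite leqNgt ltnS ltnW // eq_sym; case: eqP => // _ /(_ isT).
  apply/forallP => j; apply/implyP => /andP[/eqP ji jk].
  rewrite ltnNge leq_eqVlt; apply/negP => /orP[|lt].
    by rewrite val_eqE (inj_eq perm_inj) -val_eqE /= ji => /eqP; lia.
  have iD : i \in D by rewrite inE; apply/existsP; exists j; rewrite ji eqxx.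
  by have := h i iD; rewrite -ji eq_sym (negbTE jk).
have [D0|Dpos] := posnP #|D|.
  rewrite /= mul1n D0 addn0 -[RHS]card_ord -cardsT.
  apply: eq_card => k; rewrite !inE offP; apply/forall_inP => i.
  by rewrite (card0_eq D0).
have /card_gt0P[d dD] := Dpos.
have d1 : (d.+1 < m.+1) by rewrite ltnS.
rewrite mul0n add0n.
have [/card_le1P/(_ d dD) D1|Dgt] := leqP #|D| 1.
  have -> : #|D| = 1 by rewrite (eq_card D1) card1.
  apply: etrans (cards1 (Ordinal d1)); apply: eq_card => k; rewrite !inE offP.
  apply/forall_inP/eqP => [/(_ d dD)/eqP kE|-> i].
    exact: val_inj.
  by rewrite D1 inE => /eqP ->.
rewrite (gtn_eqF Dgt); apply/eqP; rewrite cards_eq0; apply/eqP/setP => k.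
rewrite !inE offP; apply: contraTF Dgt => /forall_inP h.
rewrite -leqNgt; apply/card_le1_eqP => i j /h/eqP ki /h/eqP kj.
by apply: val_inj; move: kj; rewrite ki => -[].
Qed.

(** Without descents every cut is valid, in particular the cut 0, which belongs to the empty set.
    The resulting expression is free of [s], which gives uniqueness in [card_des0]. *)
Lemma des0_block_perm (m : nat) (s : 'S_m) :
  des s = 0 -> s = block_perm m finset.set0.
Proof.
move=> s0; have asc : ascends_off m 0 s.
  have : [set k : 'I_m.+1 | ascends_off m k s] = [set: 'I_m.+1].
    apply/eqP; rewrite eqEcard finset.subsetT cardsT card_ord.
    by rewrite card_ascends_off s0 mul1n addn0 leqnn.
  by move=> /setP/(_ ord0); rewrite !inE.
rewrite -[LHS](ascends_block_perm m 0 s) //; congr (block_perm m _).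
by apply/setP => y; rewrite inE; apply/negP => /imsetP[i]; rewrite inE.
Qed.

Lemma card_des0 (m : nat) : #|[set s : 'S_m | des s == 0]| = 1.
Proof.
have des1 : des (1%g : 'S_m) = 0.
  apply: eq_card0 => i; rewrite !inE; apply/existsP => -[j].
  by rewrite !perm1 => /andP[/eqP ->]; rewrite ltnNge leqnSn.
apply/eqP/cards1P; exists 1%g; apply/setP => s; rewrite !inE.
apply/eqP/eqP => [s0|->//].
by rewrite (des0_block_perm m s s0) (des0_block_perm m _ des1).
Qed.

Lemma card_des1 (m : nat) : m.+1 + #|[set s : 'S_m | des s == 1]| = 2 ^ m.
Proof.
have -> : 2 ^ m = \sum_(S : {set 'I_m}) 1.
  by rewrite sum1_card -cardsT -powersetT card_powerset cardsT card_ord.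
rewrite (partition_big (block_perm m) xpredT) //=.
(* Writing [m.+1] as [m.+1] times the number of descent-free permutations turns the left side into a
   sum over [s] as well, to be compared with the fiber sizes term by term. *)
rewrite -[X in X + _]mul1n -[X in X * _](card_des0 m) -!sum1dep_card.
rewrite big_distrl /= [X in X + _]big_mkcond [X in _ + X]big_mkcond -big_split.
apply: eq_bigr => s _ /=.
rewrite sum1dep_card card_block_perm_fiber card_ascends_off.
by case: (des s) => [|[|d]].
Qed.

Local Open Scope classical_set_scope.
Local Open Scope ring_scope.

(** * The first two coefficients of the Eulerian polynomials *)

Lemma coef_eulerianA (R : realType) (m k : nat) :
  (eulerianA R m)`_k = #|[set s : 'S_m | des s == k]%SET|%:R.
Proof.
rewrite coef_sum -sum1dep_card natr_sum [RHS]big_mkcond.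
by apply: eq_bigr => s _; rewrite coefXn eq_sym; case: eqP.
Qed.

Lemma coef0_eulerianA (R : realType) (m : nat) : (eulerianA R m)`_0 = 1.
Proof. by rewrite coef_eulerianA card_des0. Qed.

Lemma coef1_eulerianA (R : realType) (m : nat) :
  (eulerianA R m)`_1 = 2 ^+ m - m%:R - 1.
Proof.
rewrite coef_eulerianA -natrX -card_des1 natrD -natr1; ring.
Qed.

(** At [k = 1] the coefficient recurrence reads [3 * b_1 + (2 * m + 1) * b_0] with [b_0 = 1]. *)
Lemma coef1_recB (R : realType) (m : nat) :
  (recB R m)`_1 = 3 ^+ m - m%:R - 1.
Proof.
elim: m => [|m IH]; first by rewrite /= coefC; ring.
have [h0 _ _] := recB_pal R m.
by rewrite coef_recBS IH h0 exprS natrD natrM -(natr1 m); ring.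
Qed.

(** * Logarithmic derivatives: sums over roots and values at 1 *)

Lemma horner_prod_XsubC (F : fieldType) (s : seq F) (a : F) :
  (\prod_(x <- s) ('X - x%:P)).[a] = \prod_(x <- s) (a - x).
Proof. by rewrite horner_prod; apply: eq_bigr => x _; rewrite !hornerE. Qed.

Lemma deriv_prod_XsubC (F : fieldType) (s : seq F) (a : F) :
  (forall x, x \in s -> x != a) ->
  (\prod_(x <- s) ('X - x%:P))^`().[a] =
  (\prod_(x <- s) (a - x)) * \sum_(x <- s) (a - x)^-1.
Proof.
elim: s => [|x s IH] h; first by rewrite !big_nil derivC hornerE mulr0.
rewrite !big_cons derivM derivXsubC mul1r !hornerE IH; last first.
  by move=> y ys; apply: h; rewrite inE ys orbT.
rewrite horner_prod_XsubC.
have : a - x != 0 by rewrite subr_eq0 eq_sym h // mem_head.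
by move=> ?; field.
Qed.

(** The size bound leaves no room for further roots, so [q] is a constant times the product of the
    ['X - x%:P]; the constant cancels in the quotient. *)
Lemma sum_inv_roots (F : fieldType) (q : {poly F}) (s : seq F) (a : F) :
  (size q <= (size s).+1)%N -> uniq s -> all (root q) s -> q.[a] != 0 ->
  \sum_(x <- s) (a - x)^-1 = q^`().[a] / q.[a].
Proof.
move=> sq us rs qa.
have q0 : q != 0 by apply: contraNneq qa => ->; rewrite horner0.
have sE : size q = (size s).+1.
  by apply/eqP; rewrite eqn_leq sq; exact: max_poly_roots.
have qE := all_roots_prod_XsubC sE rs; rewrite uniq_rootsE in qE.
have {}qE := qE us.
have sa x : x \in s -> x != a.
  by move=> xs; apply: contraNneq qa => <-; exact: (allP rs).
move: qa; rewrite qE derivZ !hornerZ deriv_prod_XsubC // horner_prod_XsubC.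
move: (lead_coef q) => c; rewrite mulf_eq0 negb_or => /andP[c0 p0].
by field; rewrite c0 p0.
Qed.

(** Multiplying by [t] clears the denominators: [t q(t^2)] is the polynomial with terms
    [c p_k (t - 1)^k (1 + t)^(d - k)]. Its degree is at most [d], which bounds that of [q]; its
    value and derivative at 1 are [q(1)] and [q(1) + 2 q'(1)]. *)
Lemma homogenized_log_deriv (R : realType) (d : nat) (c : R) (p q : {poly R}) :
  (size p <= d.+1)%N -> p`_0 = 1 -> c != 0 -> (0 < d)%N ->
  (forall t, 0 < t < 1 ->
     q.[t ^+ 2] = c * ((1 + t) ^+ d / t) * p.[- ((1 - t) / (1 + t))]) ->
  [/\ ((size q).*2 <= d.+1)%N, q.[1] != 0
    & q^`().[1] / q.[1] = (d%:R + p`_1 - 2) / 4].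
Proof.
case: d => // d sp p0 c0 _ hq.
pose h := c *: \sum_(k < d.+2) p`_k *: (('X - 1) ^+ k * (1 + 'X) ^+ (d.+1 - k)).
have hE : 'X * (q \Po 'X^2) = h.
  apply: poly_eq_near0 => t t01; have /andP[t0 t1] := t01.
  have tn0 : t != 0 by rewrite gt_eqF.
  have tn1 : 1 + t != 0 by rewrite gt_eqF // addr_gt0.
  rewrite hornerM hornerX horner_comp hornerXn hq // hornerZ horner_sum.
  rewrite (horner_coef_wide _ sp).
  have -> : t * (c * ((1 + t) ^+ d.+1 / t) *
     \sum_(i < d.+2) p`_i * (- ((1 - t) / (1 + t))) ^+ i) =
     c * ((1 + t) ^+ d.+1 * \sum_(i < d.+2) p`_i * (- ((1 - t) / (1 + t))) ^+ i).
    by field.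
  congr (_ * _); rewrite mulr_sumr; apply: eq_bigr => k _.
  have kd : (k <= d.+1)%N by rewrite -ltnS.
  have -> : (1 + t) ^+ d.+1 = (1 + t) ^+ (d.+1 - k) * (1 + t) ^+ k.
    by rewrite -exprD subnK.
  have -> : - ((1 - t) / (1 + t)) = (t - 1) / (1 + t) by rewrite -mulNr opprB.
  rewrite expr_div_n !(hornerE, horner_exp).
  have e1 : (1 + t) ^+ k != 0 by rewrite expf_neq0.
  by move=> /=; field.
have sh : (size h <= d.+2)%N.
  apply: (leq_trans (size_scale_leq _ _)).
  apply: (leq_trans (size_sum _ _ _)); apply/bigmax_leqP => k _.
  apply: (leq_trans (size_scale_leq _ _)).
  have -> : 1 + 'X = 'X - (- 1)%:P :> {poly R} by rewrite polyCN opprK addrC.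
  apply: (leq_trans (size_polyMleq _ _)); rewrite -polyC1 !size_exp_XsubC.
  by have := ltn_ord k; lia.
(* The factor [(t - 1)^k] kills all terms but [k = 0] in the value at 1, and all but [k = 0] and
   [k = 1] in the derivative. *)
have h1 : h.[1] = c * 2 ^+ d.+1.
  rewrite hornerZ horner_sum big_ord_recl big1 /= => [|k _].
    by rewrite !(hornerE, horner_exp) p0 subn0 /=; ring.
  rewrite /bump /= !(hornerE, horner_exp) subrr exprS /=; ring.
have h1' : h^`().[1] = c * 2 ^+ d * (d.+1%:R + p`_1).
  rewrite derivZ hornerZ raddf_sum horner_sum /= 2!big_ord_recl big1 /= => [|k _].
    rewrite /bump /= !derivZ !derivM !deriv_exp !derivB !derivD derivX derivC.
    rewrite !(hornerE, horner_exp, hornerMn) p0 subn0 subSS subn0 /= -mulr_natl.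
    rewrite !(hornerE, horner_exp, hornerMn) /= subrr mul0r; ring.
  rewrite derivZ hornerZ exprS [('X - 1) ^+ _]exprS -!mulrA.
  move: (('X - 1) ^+ _ * _) => g; rewrite !derivM !derivB derivX derivC.
  by rewrite !(hornerE, horner_exp) subrr /=; ring.
have q1 : q.[1] = c * 2 ^+ d.+1.
  by rewrite -h1 -hE hornerM hornerX horner_comp hornerXn expr1n mul1r.
have q1' : q.[1] + 2 * q^`().[1] = c * 2 ^+ d * (d.+1%:R + p`_1).
  rewrite -h1' -hE derivM derivX deriv_comp derivXn.
  rewrite !(hornerE, horner_comp, hornerMn) expr1n; ring.
have nz : q.[1] != 0 by rewrite q1 mulf_neq0 ?expf_neq0 // pnatr_eq0.
split=> //.
  (* The size of ['X * (q \Po 'X^2)] is twice that of [q]. *)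
  move: sh; rewrite -hE.
  have q0 : q != 0 by apply: contraNneq nz => ->; rewrite horner0.
  have qx0 : q \Po 'X^2 != 0.
    apply: contraNneq nz => /(congr1 (horner^~ 1)).
    by rewrite horner_comp hornerXn expr1n horner0 => ->.
  rewrite mulrC size_mulX //.
  have := size_comp_poly q 'X^2; rewrite size_polyXn /=.
  move: q0 qx0; rewrite -!size_poly_gt0; move: (size q) (size (q \Po _)) => a b. lia.
have -> : q^`().[1] = q.[1] * ((d.+1%:R + p`_1 - 2) / 4).
  move: q1'; rewrite q1 exprS => e; lra.
by field.
Qed.

(** * Exponential rates from two-sided bounds *)

Lemma ln_double_over_cvg0 (R : realType) :
  (fun n : nat => n%:R^-1 * ln (2 * n%:R : R)) @ \oo --> (0 : R).
Proof.
apply/cvgr0Pnorm_le => e e0.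
(* [n * expR (- e) ^+ n] tends to 0, so eventually [2 * n <= expR (n * e)]. *)
have w1 : expR (- e) < 1 by rewrite expR_lt1 oppr_lt0.
have := natX_geometric_cvg0 1 (expR_ge0 _) w1.
move=> /cvgr0Pnorm_le/(_ (2^-1)); rewrite invr_gt0 ltr0n => /(_ isT) h.
near=> n.
have n1 : (1 <= n)%N by near: n; exists 1%N.
have n0 : 1 <= n%:R :> R by rewrite ler1n.
have : `|n%:R ^+ 1 * expR (- e) ^+ n| <= 2^-1 by near: n; exact: h.
rewrite expr1 ger0_norm ?mulr_ge0 ?exprn_ge0 ?expR_ge0 //.
rewrite -expRM_natl mulrN expRN => hn.
have {}hn : 2 * n%:R <= expR (n%:R * e).
  move: hn; rewrite ler_pdivrMr ?expR_gt0 //; lra.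
rewrite ger0_norm; last by rewrite mulr_ge0 ?invr_ge0 ?ln_ge0 //; lra.
rewrite mulrC ler_pdivrMr; last lra.
rewrite -[leRHS]expRK ler_ln ?posrE ?expR_gt0 ?[e * _]mulrC //; lra.
Unshelve. all: by end_near. Qed.

(** After taking logarithms and dividing by [n], the factor [2 * n] contributes only
    [ln (2 * n) / n], which tends to 0. *)
Lemma cvg_ln_geometric (R : realType) (a : R) (y : nat -> R) : 0 < a ->
  (forall n, (1 <= n)%N -> a ^- n <= y n <= 2 * n%:R * a ^- n) ->
  (fun n : nat => n%:R^-1 * ln (y n)) @ \oo --> - ln a.
Proof.
move=> a0 hy.
apply: (@squeeze_cvgr _ _ _ _ (fun=> - ln a)
   (fun n => n%:R^-1 * ln (2 * n%:R) - ln a)).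
- exists 1%N => // n /= n1.
  have /andP[lo hi] := hy _ n1.
  have n0 : 0 < n%:R :> R by rewrite ltr0n.
  have an0 : 0 < a ^- n by rewrite invr_gt0 exprn_gt0.
  have y0 : 0 < y n by apply: lt_le_trans lo.
  have lan : ln (a ^- n) = - (n%:R * ln a).
    by rewrite lnV ?posrE ?exprn_gt0 // lnXn // mulr_natl.
  have n2 : 0 < 2 * n%:R :> R by rewrite mulr_gt0.
  apply/andP; split.
    rewrite mulrC ler_pdivlMr // mulNr [ln a * _]mulrC -lan.
    by rewrite ler_ln // posrE.
  rewrite -(ler_pM2l n0) mulrBr !mulrA !divff ?gt_eqF // !mul1r -lan.
  by rewrite -lnM ?posrE // ler_ln ?posrE // mulr_gt0.
- exact: cvg_cst.
- rewrite -[X in _ --> X]add0r; apply: cvgB; last exact: cvg_cst.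
  exact: ln_double_over_cvg0.
Qed.

(** * Bounds on the largest zero *)

Lemma zeros_in01_bounds (R : realType) (q : {poly R}) (N : nat) (x : nat -> R) :
  (0 < N)%N -> (size q <= N.+1)%N -> q.[1] != 0 -> zeros_in01 q N x ->
  0 < q^`().[1] / q.[1] ->
  (q^`().[1] / q.[1])^-1 <= 1 - x N <= N%:R * (q^`().[1] / q.[1])^-1.
Proof.
move=> N0 sq q1 [x01 xinc xroot].
have mono i j : (1 <= i)%N -> (i < j)%N -> (j <= N)%N -> x i < x j.
  move=> i1; elim: j => // j IH; rewrite ltnS leq_eqVlt => /orP[/eqP <-|ij] jN.
    exact: xinc.
  by apply: (lt_trans (IH ij (ltnW jN))); apply: xinc => //; lia.
pose s := [seq x i | i <- iota 1 N].
have us : uniq s.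
  rewrite map_inj_in_uniq ?iota_uniq // => i j.
  rewrite !mem_iota => hi hj e.
  have [ij|ij|//] := ltngtP i j.
    by suff : x i < x j by [rewrite e ltxx]; apply: mono => //; lia.
  by suff : x j < x i by [rewrite e ltxx]; apply: mono => //; lia.
have rs : all (root q) s.
  apply/allP => y /mapP[i + ->]; rewrite mem_iota => i_rng.
  by apply/(xroot (x i)); exists i => //; lia.
have sz : (size q <= (size s).+1)%N by rewrite size_map size_iota.
rewrite -(@sum_inv_roots _ q s 1) // => S0; set S := \sum_(_ <- _) _ in S0 *.
have SE : S = \sum_(1 <= i < N.+1) (1 - x i)^-1.
  by rewrite /S big_map /index_iota subSS subn0.
have /andP[xN0 xN1] : 0 < x N < 1 by apply: x01; lia.
have y0 : 0 < 1 - x N by lra.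
have lo : (1 - x N)^-1 <= S.
  rewrite SE big_nat_recr //= lerDr big_nat_cond; apply: sumr_ge0 => i.
  rewrite andbT => hi; rewrite invr_ge0.
  have : 0 < x i < 1 by apply: x01; lia.
  by lra.
have up : S <= N%:R * (1 - x N)^-1.
  rewrite SE; apply: (@le_trans _ _ (\sum_(1 <= i < N.+1) (1 - x N)^-1)).
    apply: ler_sum_nat => i i_rng.
    have /andP[_ xi1] : 0 < x i < 1 by apply: x01; lia.
    rewrite lef_pV2 ?posrE; [|lra|lra].
    have [->//|iN] := eqVneq i N.
    have : x i < x N by apply: mono; lia.
    by lra.
  by rewrite sumr_const_nat subSS subn0 mulr_natl.
apply/andP; split.
  by rewrite -[leRHS]invrK lef_pV2 ?posrE // invr_gt0.
by rewrite ler_pdivlMr // mulrC -ler_pdivlMr.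
Qed.

(** Here [b] is a pure power that replaces the exact logarithmic derivative [S]. Since
    [S <= b <= 2 * S], the replacement costs only the factor 2 in the upper bound. *)
Lemma last_zero_bounds (R : realType) (N : nat) (b c : R) (p q : {poly R})
    (x : nat -> R) :
  (0 < N)%N -> 0 < b -> c != 0 -> (size p <= (2 * N).+2)%N -> p`_0 = 1 ->
  (forall t, 0 < t < 1 ->
     q.[t ^+ 2] =
     c * ((1 + t) ^+ (2 * N).+1 / t) * p.[- ((1 - t) / (1 + t))]) ->
  zeros_in01 q N x ->
  b <= 2 * (((2 * N).+1%:R + p`_1 - 2) / 4) ->
  ((2 * N).+1%:R + p`_1 - 2) / 4 <= b ->
  b^-1 <= 1 - x N <= 2 * N%:R * b^-1.
Proof.
move=> N0 b0 c0 sp p0 hq hz.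
have [sq q1 <-] := homogenized_log_deriv _ _ _ _ _ sp p0 c0 (ltn0Sn _) hq.
set S := _ / q.[1] => lo hi.
have S0 : 0 < S by lra.
(* With [d = 2 * N + 1] the degree bound says that the [N] listed zeros are all that [q] can
   have. *)
have sqN : (size q <= N.+1)%N by lia.
have /andP[lox hix] := zeros_in01_bounds _ _ _ _ N0 sqN q1 hz S0.
apply/andP; split.
  by apply: le_trans lox; rewrite lef_pV2.
apply: (le_trans hix); rewrite [2 * _]mulrC -mulrA ler_wpM2l //.
by rewrite ler_pdivlMr // ler_pdivrMl // mulrC.
Qed.

(** * The two limits, with rates 4 and 9 *)

Theorem theorem2p1 (R : realType) (xXi xLambda : nat -> nat -> R)
  (hXi : forall n : nat, (2 <= n)%N -> zeros_in01 (XiT R n) (n - 1) (xXi n))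
  (hLambda : forall n : nat, (2 <= n)%N ->
     zeros_in01 (LambdaT R n) (n - 1) (xLambda n)) :
  ((fun n : nat => ((n - 1)%N%:R)^-1 * ln (1 - xLambda n (n - 1)%N)) @ \oo
     --> - ln (4 : R))
  /\
  ((fun n : nat => ((n - 1)%N%:R)^-1 * ln (1 - xXi n (n - 1)%N)) @ \oo
     --> - ln (9 : R)).
Proof.
have signed_neq0 n (u v : R) : u != 0 -> v != 0 -> (-1) ^+ n / (u * v) != 0.
  by move=> u0 v0; rewrite mulf_neq0 ?signr_eq0 // invr_neq0 // mulf_neq0.
have fact_neq0 n : n`!%:R != 0 :> R by rewrite pnatr_eq0 -lt0n fact_gt0.
have pow_ge (a N : nat) : (0 < N)%N -> (0 < a)%N -> a%:R <= a%:R ^+ N :> R.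
  by move=> N0 a0; apply: ler_eXnr => //; rewrite ler1n.
have ne0 (t : R) : 0 < t -> t != 0 /\ t != -1.
  by move=> t0; rewrite !gt_eqF // (lt_trans _ t0) // oppr_lt0.
(* The sequences are reindexed by the number [N = n - 1] of zeros. *)
split; rewrite -cvg_shiftS; under eq_fun do rewrite subn1 /=.
  apply: (@cvg_ln_geometric R 4 (fun N => 1 - xLambda N.+1 N)) => // N N1.
  have := hLambda N.+1; rewrite ltnS subn1 => /(_ N1) hz.
  have dE : (2 * N.+1)%N = (2 * N).+2 by lia.
  have dE1 : (2 * N.+1 - 1)%N = (2 * N).+1 by lia.
  have p1 := coef1_eulerianA R (2 * N).+2.
  have S_eq : ((2 * N).+1%:R + (eulerianA R (2 * N).+2)`_1 - 2) / 4
              = 4 ^+ N - 1 :> R.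
    have -> : 4 ^+ N = 2 ^+ (2 * N) :> R by rewrite exprM; congr (_ ^+ _); ring.
    by rewrite p1 !exprS -!(natr1 (2 * N).+1); field.
  (* From [4 <= 4 ^+ N] it follows that [4 ^+ N] is at most twice [4 ^+ N - 1]; this needs [N]
     positive. *)
  have N4 := pow_ge 4%N N N1 isT.
  apply: (last_zero_bounds R N _
    ((-1) ^+ N.+2 / ((2 ^+ (2 * N.+1 + 1) - 1) * (2 * N.+1)`!%:R))
    (eulerianA R (2 * N).+2) _ _ N1) hz _ _ => //.
  - by rewrite exprn_gt0.
  - apply: signed_neq0 => //; rewrite subr_eq0 gt_eqF // exprn_egt1 ?ltr1n // addn1.
  - exact: (eulerianA_pal R _).1.
  - exact: coef0_eulerianA.
  - move=> t /andP[/ne0[t0 t1] _].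
    by rewrite -LambdaTP // LambdaP // dE1 dE.
  - by rewrite S_eq; lra.
  - by rewrite S_eq; lra.
apply: (@cvg_ln_geometric R 9 (fun N => 1 - xXi N.+1 N)) => // N N1.
have := hXi N.+1; rewrite ltnS subn1 => /(_ N1) hz.
have dE1 : (2 * N.+1 - 1)%N = (2 * N).+1 by lia.
have p1 := coef1_recB R (2 * N).+1.
have S_eq : ((2 * N).+1%:R + (recB R (2 * N).+1)`_1 - 2) / 4
            = 3 * (9 ^+ N - 1) / 4 :> R.
  have -> : 9 ^+ N = 3 ^+ (2 * N) :> R by rewrite exprM; congr (_ ^+ _); ring.
  by rewrite p1 !exprS; field.
(* Likewise [9 ^+ N] lies between [3 * (9 ^+ N - 1) / 4] and twice that value. *)
have N9 := pow_ge 9%N N N1 isT.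
have [rec0 _ _] := recB_pal R (2 * N).+1.
apply: (last_zero_bounds R N _
  ((-1) ^+ N.+2 / (2 ^+ (4 * N.+1 - 1) * (2 * N.+1 - 1)`!%:R))
  (recB R (2 * N).+1) _ _ N1) hz _ _ => //.
- by rewrite exprn_gt0.
- by apply: signed_neq0 => //; rewrite expf_neq0 // pnatr_eq0.
- by rewrite size_recB.
- move=> t /andP[/ne0[t0 t1] _].
  by rewrite -XiTP // XiP // eulerianBE dE1.
- by rewrite S_eq; lra.
- by rewrite S_eq; lra.
Qed.
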